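(* Let $X$ be a finite dimensional normed space, $A$ a closed set, $f$ l.s.c. on $\Omega$, $\varphi$ l.s.c. on $A \times \{ p_0 \}$, and suppose that there exists a non-decreasing function $\omega \colon \mathbb{R}_+ \to \mathbb{R}_+$ such that $\omega(t) = 0$ iff $t = 0$ and $\varphi(x, p) \ge \omega(d(p, p_0))$ for all $(x, p) \in A \times P$. Then the parametric penalty function $F_{\lambda}$ is globally exact if and only if $F_{\lambda}$ is exact at every globally optimal solution of the problem $(\mathcal{P})$ and there exists $\mu \ge 0$ such that the set $\{ x \in A \mid \inf_{p \in P} F_{\mu}(x, p) < f^* \}$ is either bounded or empty, and the function $F_{\mu}$ is bounded below on $A \times P$.
   Context: Setting. $M, A \subset X$ are nonempty, $f \colon X \to \mathbb{R} \cup \{+\infty\}$ with $\operatorname{dom} f = \{x : |f(x)| < +\infty\} \ne \emptyset$. The problem $(\mathcal{P})$ is: minimize $f(x)$ subject to $x \in M$, $x \in A$. Put $\Omega = M \cap A$; it is assumed that $f$ attains a global minimum on $\Omega$, with finite value $f^* = \min_{x\in\Omega} f(x)$. $P$ is a metric space, $p_0 \in P$ is fixed, and $\varphi \colon X \times P \to [0, +\infty]$ satisfies $\varphi(x, p) = 0$ iff $p = p_0$ and $x \in M$. The parametric penalty function is $F_{\lambda}(x, p) = f(x) + \lambda \varphi(x, p)$, $\lambda \ge 0$. $\mathbb{R}_+ = [0, +\infty)$. Global exactness: $F_\lambda$ is (globally) exact if there exists $\lambda_0 \ge 0$ such that $F_{\lambda_0}$ attains a global minimum on $A \times P$, and $(x^*,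 p^* )$ is a global minimizer of $F_{\lambda_0}$ on $A\times P$ iff $p^* = p_0$ and $x^*$ is a globally optimal solution of $(\mathcal{P})$. Local exactness: $F_\lambda$ is exact at a locally optimal solution $x^* \in \operatorname{dom} f$ of $(\mathcal{P})$ if there exists $\lambda_0 \ge 0$ such that $(x^*, p_0)$ is a local minimizer of $F_{\lambda_0}$ on $A \times P$. ''L.s.c. on a set'' means lower semicontinuous at every point of that set. *)

(* Defs.v *)
From HB Require Import structures.
From mathcomp Require Import all_boot all_order all_algebra.
From mathcomp Require Import all_classical all_reals all_analysis.

Set Implicit Arguments.
Unset Strict Implicit.
Unset Printing Implicit Defensive.

Import Order.TTheory GRing.Theory Num.Theory.
Import numFieldNormedType.Exports.

Local Open Scope classical_set_scope.
Local Open Scope ring_scope.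

Definition finite_dimensional (R : realType) (X : normedModType R) : Prop :=
  exists n : nat, inhabited (Vector.axiom n X).

(* The pointwise clause is the one of [lower_semicontinuous]; neighbourhoods are
   taken in the whole space [T], not relatively to [D]. *)
Definition lsc_on (R : realType) (T : topologicalType) (D : set T)
    (g : T -> \bar R) : Prop :=
  forall x, D x -> forall a : R, (a%:E < g x)%E ->
    \forall y \near x, (a%:E < g y)%E.

Definition global_minimizer (R : realType) (T : Type) (D : set T)
    (g : T -> \bar R) (z : T) : Prop :=
  D z /\ forall w, D w -> (g z <= g w)%E.

Definition local_minimizer (R : realType) (T : topologicalType) (D : set T)
    (g : T -> \bar R) (z : T) : Prop :=
  D z /\ \forall w \near z, D w -> (g z <= g w)%E.

Definition dom (R : realType) (T : Type) (f : T -> \bar R) : set T :=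
  [set x | f x \is a fin_num].

Section ParametricPenalty.
Context {R : realType} {X : normedModType R} {P : metricType R}.
Variables (M A : set X) (f : X -> \bar R) (phi : X * P -> \bar R) (p0 : P).

Definition feasible : set X := M `&` A.

Definition optimal_solution (x : X) : Prop := global_minimizer feasible f x.

Definition optimal_value : \bar R := ereal_inf (f @` feasible).

(* The product in [\bar R] follows the convention 0 * +oo = 0, so that F_0(x, p)
   is f(x) even where phi(x, p) = +oo. *)
Definition penalty (lambda : R) (z : X * P) : \bar R :=
  (f z.1 + lambda%:E * phi z)%E.

Definition globally_exact : Prop :=
  exists lambda0 : R, [/\ 0 <= lambda0,
    exists z, global_minimizer (A `*` [set: P]) (penalty lambda0) z &
    forall x p, global_minimizer (A `*` [set: P]) (penalty lambda0) (x, p) <->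
      p = p0 /\ optimal_solution x].

Definition exact_at (x : X) : Prop :=
  exists2 lambda0 : R, 0 <= lambda0 &
    local_minimizer (A `*` [set: P]) (penalty lambda0) (x, p0).

End ParametricPenalty.

(* Main.v *)
(* If no natural number k makes f* a lower bound of F_k, choose z_k = (x_k, p_k)
   in A x P with F_k(z_k) < f*. The bound c <= F_mu forces phi(z_k) -> 0, hence
   p_k -> p_0 through omega, while x_k stays in the bounded sublevel set. A
   cluster point x of (x_k) is feasible and optimal by lower semicontinuity, and
   (z_k) contradicts exactness at x. Once f* is a lower bound of F_k, increasing
   the parameter to k + 1 excludes every minimizer with phi > 0. *)
Require Import Defs.
From HB Require Import structures.
From mathcomp Require Import all_boot all_order all_algebra.
From mathcomp Require Import all_classical all_reals all_analysis.
From mathcomp Require Import lra.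

Set Implicit Arguments.
Unset Strict Implicit.
Unset Printing Implicit Defensive.

Import Order.TTheory GRing.Theory Num.Theory.
Import numFieldNormedType.Exports.

Local Open Scope classical_set_scope.
Local Open Scope ring_scope.

(** * Compactness in finite-dimensional normed spaces *)

Lemma bounded_setP (R : realType) (X : normedModType R) (K : set X) :
  bounded_set K <-> exists B, K `<=` [set x | `|x| <= B].
Proof.
split=> [/ex_strict_bound_gt0[B _ KB]|[B KB]].
  by exists B => x /KB /ltW.
by apply: filterS (nbhs_pinfty_ge (num_real B)) => r /= Br x /KB /le_trans; apply.
Qed.

Lemma mx_entry_le_norm (R : realType) (m n : nat) (u : 'M[R]_(m, n)) i j :
  `|u i j| <= `|u|.
Proof.
rewrite [leRHS]/Num.norm /= mx_normrE; apply/bigmax_geP; right.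
by exists (i, j).
Qed.

(** Expanding [u] in the standard basis bounds [g] by the sum of the norms of the basis images,
    since each entry is at most the sup norm of [u]. *)
Lemma linear_rV_continuous (R : realType) (X : normedModType R) (n : nat)
    (g : {linear 'rV[R]_n -> X}) : continuous g.
Proof.
apply: bounded_linear_continuous; apply/linear_boundedP.
apply: filterS (nbhs_pinfty_ge (num_real (\sum_(j < n) `|g (delta_mx 0 j)|))).
move=> r /= le_r u; apply: le_trans (ler_wpM2r (normr_ge0 u) le_r).
rewrite {1}[u]row_sum_delta linear_sum mulr_suml.
apply: le_trans (ler_norm_sum _ _ _) _; apply: ler_sum => j _.
by rewrite linearZ normrZ mulrC ler_wpM2l// mx_entry_le_norm.
Qed.

(* The norm of [g] attains a positive minimum on the compact unit sphere. *)
Lemma injective_linear_rV_coercive (R : realType) (X : normedModType R)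
    (n : nat) (g : {linear 'rV[R]_n -> X}) : injective g ->
  exists2 c : R, 0 < c & forall u, c * `|u| <= `|g u|.
Proof.
move=> g_inj; pose S : set 'rV[R]_n := [set u | `|u| = 1].
have cS : compact S.
  apply: bounded_closed_compact.
    by apply/bounded_setP; exists 1 => u /= ->.
  rewrite (_ : S = Num.norm @^-1` [set 1]) //; apply: preimage_closed.
    by move=> u _; exact: norm_continuous.
  exact: closed_eq.
have unitS u : u != 0 -> S (`|u|^-1 *: u).
  by move=> u0; rewrite /S /= normrZ normfV normr_id mulVf// normr_eq0.
(* An empty sphere means dimension zero: every [u] is then 0 and any positive constant works. *)
have [S0|/set0P Sn0] := eqVneq S set0.
  exists 1 => // u.
  have [->|/unitS] := eqVneq u 0; first by rewrite normr0 mulr0.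
  by rewrite S0.
have cg : {within S, continuous (fun u => `|g u|)}.
  apply: continuous_subspaceT => u.
  apply: (@cvg_comp _ _ _ g Num.norm); first exact: linear_rV_continuous.
  exact: norm_continuous.
have [u0 /set_mem Su0 u0min] := @compact_EVT_min _ _ _ _ Sn0 cS cg.
exists `|g u0|.
  rewrite normr_gt0; apply/eqP => gu0.
  have : u0 = 0 by apply: g_inj; rewrite gu0 linear0.
  move=> u00; move: Su0; rewrite /S /= u00 normr0 => /esym/eqP.
  by rewrite oner_eq0.
move=> u; have [->|un0] := eqVneq u 0; first by rewrite normr0 mulr0.
have := u0min _ (mem_set (unitS _ un0)).
by rewrite linearZ normrZ normfV normr_id mulrC ler_pdivlMr// normr_gt0.
Qed.

(** [finite_dimensional] provides only a linear bijection with row vectors. Its inverse [G] is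
    continuous and coercive, so the preimage of [K] is closed and bounded, hence compact, and [K] is
    its image. *)
Lemma finite_dimensional_bounded_closed_compact (R : realType)
    (X : normedModType R) (K : set X) :
  finite_dimensional X -> bounded_set K -> closed K -> compact K.
Proof.
move=> [n [[h h_lin [g hK gK]]]] Kbnd Kcl.
have g_lin : linear g by move=> a u v; apply: (can_inj hK); rewrite h_lin !gK.
pose G : {linear 'rV[R]_n -> X} :=
  HB.pack g (GRing.isLinear.Build _ _ _ _ g g_lin).
have [c c0 cG] := @injective_linear_rV_coercive _ _ _ G (can_inj gK).
have /bounded_setP[B KB] := Kbnd.
have -> : K = G @` (G @^-1` K).
  apply/seteqP; split=> [x Kx|_ [u Ku <-]//].
  by exists (h x); rewrite /= hK.
apply: continuous_compact.
  exact/continuous_subspaceT/linear_rV_continuous.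
apply: bounded_closed_compact.
  apply/bounded_setP; exists (c^-1 * B) => u /= Ku.
  rewrite mulrC ler_pdivlMr// mulrC (le_trans (cG u))//.
  exact: KB.
by apply: preimage_closed => // u _; exact: linear_rV_continuous.
Qed.

(** * Cluster points and lower semicontinuity *)

Lemma cluster_image (T U : topologicalType) (F : set_system T) (h : T -> U)
    (x : T) : {for x, continuous h} -> cluster F x -> cluster (h @ F) (h x).
Proof.
move=> hx Fx E W FE nW.
by have [w [Ew Ww]] := Fx _ _ FE (hx _ nW); exists (h w).
Qed.

(** Convergence of the second component keeps it near [y] on a set of the filter; the first
    component still clusters at [x] along that set, so both are met at a common index. *)
Lemma cluster_pair (T U : topologicalType) (I : Type) (F : set_system I)
    {FF : Filter F} (z : I -> T * U) (x : T) (y : U) :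
  cluster ((fst \o z) @ F) x -> (snd \o z) @ F --> y -> cluster (z @ F) (x, y).
Proof.
move=> zx zy E W FE [[V1 V2] /= [nV1 nV2] VW].
have FV2 : F [set i | V2 (z i).2] by exact: zy.
have /zx /(_ nV1) : ((fst \o z) @ F) (fst @` (E `&` [set w | V2 w.2])).
  have : F [set i | E (z i) /\ V2 (z i).2] by exact: filterI.
  by apply: (@filterS _ F) => i /= Ei; exists (z i).
move=> [_ [[w [Ew V2w] <-] V1w]]; exists w; split=> //.
by apply: VW; split.
Qed.

Lemma cluster_lsc_le (R : realType) (T : topologicalType) (F : set_system T)
    (D : set T) (g : T -> \bar R) (x : T) (a : R) :
  cluster F x -> lsc_on D g -> D x -> F [set y | (g y <= a%:E)%E] ->
  (g x <= a%:E)%E.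
Proof.
move=> Fx g_lsc Dx Fg; rewrite leNgt; apply/negP => /(g_lsc _ Dx) ax.
by have [y [/= ya]] := Fx _ _ Fg ax; rewrite ltNge ya.
Qed.

Lemma optimal_valueE (R : realType) (X : normedModType R) (M A : set X)
    (f : X -> \bar R) (x : X) :
  optimal_solution M A f x -> optimal_value M A f = f x.
Proof.
move=> [Ox xmin]; apply/eqP; rewrite eq_le; apply/andP; split.
  by apply: ereal_inf_lbound; exists x.
by apply: le_ereal_inf_tmp => _ [y Oy <-]; exact: xmin.
Qed.

(** * Monotonicity, finiteness and exactness of the penalty function *)

Section penalty_theory.
Context {R : realType} {X : normedModType R} {P : metricType R}.
Variables (M A : set X) (f : X -> \bar R) (phi : X * P -> \bar R) (p0 : P).
Hypothesis f_gtNy : forall x, f x != -oo%E.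
Hypothesis phi_ge0 : forall z, (0 <= phi z)%E.
Hypothesis phi_eq0 : forall x p, phi (x, p) = 0%E <-> p = p0 /\ M x.
Implicit Types (l : R) (z : X * P) (x : X).

Lemma penalty_ge l z : 0 <= l -> (f z.1 <= penalty f phi l z)%E.
Proof. by move=> l0; rewrite leeDl// mule_ge0// lee_fin. Qed.

Lemma le_penalty l1 l2 z : l1 <= l2 ->
  (penalty f phi l1 z <= penalty f phi l2 z)%E.
Proof. by move=> l12; rewrite leeD2l// lee_wpmul2r// lee_fin. Qed.

Lemma penalty_feasible l x : M x -> penalty f phi l (x, p0) = f x.
Proof. by move=> Mx; rewrite /penalty (phi_eq0 x p0).2// mule0 adde0. Qed.

(** Strict positivity of [l] matters: by the convention 0 * +oo = 0, a zero parameter would not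
    detect [phi z = +oo]. *)
Lemma penalty_lt_fin l z (v : R) : 0 < l -> (penalty f phi l z < v%:E)%E ->
  exists a b : R, [/\ f z.1 = a%:E, phi z = b%:E, 0 <= b & a + l * b < v].
Proof.
rewrite /penalty => l0; have := f_gtNy z.1; have := phi_ge0 z.
case: (f z.1) => [a| |]; case: (phi z) => [b| |] //=.
  by rewrite lee_fin -EFinM -EFinD lte_fin => b0 _ ab; exists a, b.
all: by rewrite gt0_muley.
Qed.

Lemma penalty_lower_bound_exact l (xs : X) (v : R) : 0 <= l ->
  optimal_solution M A f xs -> f xs = v%:E ->
  (forall z, A z.1 -> (v%:E <= penalty f phi l z)%E) ->
  globally_exact M A f phi p0.
Proof.
move=> l0 xs_opt fxs lb; exists (l + 1).
have l1_gt0 : 0 < l + 1 by rewrite ltr_wpDl.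
have lb1 z : A z.1 -> (v%:E <= penalty f phi (l + 1) z)%E.
  by move=> /lb /le_trans; apply; apply: le_penalty; rewrite lerDl.
have opt_min x : optimal_solution M A f x ->
    global_minimizer (A `*` setT) (penalty f phi (l + 1)) (x, p0).
  move=> [[Mx Ax] xmin]; split=> // w [Aw _].
  rewrite penalty_feasible//; apply: le_trans (lb1 _ Aw).
  by rewrite -fxs xmin//; case: xs_opt.
split; [exact: ltW|by exists (xs, p0); exact: opt_min|].
move=> x p; split=> [[[/= Ax _] xpmin]|[-> /opt_min//]].
have [[Mxs Axs] xsmin] := xs_opt.
have := xpmin (xs, p0) (conj Axs I); rewrite penalty_feasible// fxs => le_v.
(* Any real above [v] would do: the strict bound only serves to make [f x] and [phi (x, p)]
   finite. *)
have : (penalty f phi (l + 1) (x, p) < (v + 1)%:E)%E.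
  by rewrite (le_lt_trans le_v)// lte_fin ltrDl.
move=> /(penalty_lt_fin l1_gt0) [a [b [/= fa phib b0 _]]].
have := lb (x, p) Ax; move: le_v; rewrite /penalty /= fa phib.
rewrite -!EFinM -!EFinD !lee_fin => le_v ge_v.
(* Compare [a + (l + 1) * b <= v] with [v <= a + l * b]: the extra unit of penalty leaves
   [b <= 0]. *)
have b_eq0 : b = 0.
  by apply/eqP; rewrite eq_le b0 andbT -(lerD2l (a + l * b)) addr0; lra.
move: phib; rewrite b_eq0 => /phi_eq0 [-> Mx]; split=> //; split=> // y Oy.
rewrite (le_trans _ (xsmin _ Oy))// fxs fa lee_fin.
by move: le_v; rewrite b_eq0; lra.
Qed.

(** * Sequences along which the penalty function stays below the optimal value *)

Section penalty_sequence.
Variables (z : nat -> X * P) (v mu c : R).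
Hypothesis z_A : forall k, A (z k).1.
Hypothesis z_lt : forall k, (penalty f phi k%:R (z k) < v%:E)%E.
Hypothesis z_ge : forall k, (c%:E <= penalty f phi mu (z k))%E.

(* Subtracting the two bounds on [z k] gives [(k - mu) * phi (z k) < v - c]. *)
Lemma phi_sequence_small (e : R) : 0 < e ->
  \forall k \near \oo, (phi (z k) < e%:E)%E.
Proof.
move=> e0; near=> k.
have k0 : 0 < k%:R :> R by near: k; exact: nbhs_infty_gtr.
have kmu : mu < k%:R by near: k; exact: nbhs_infty_gtr.
(* This threshold is [v - c < (k - mu) * e] rearranged. *)
have ke : mu + (v - c) / e < k%:R by near: k; exact: nbhs_infty_gtr.
have [a [b [fa phib b0 lt_v]]] := penalty_lt_fin k0 (z_lt k).
have := z_ge k; rewrite /penalty fa phib -EFinM -EFinD lee_fin lte_fin => ge_c.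
have : v - c < (k%:R - mu) * e.
  by rewrite -ltr_pdivrMr// ltrBrDl.
have : (k%:R - mu) * b < v - c by lra.
by move=> /lt_trans/[apply]; rewrite ltr_pM2l// subr_gt0.
Unshelve. all: by end_near. Qed.

(** A distance of at least [e] would force [phi (z k)] to be at least [omega e], which fails
    eventually because [omega e] is positive. *)
Lemma parameter_sequence_cvg (omega : R -> R) :
  (forall s t, 0 <= s -> s <= t -> omega s <= omega t) ->
  (forall t, 0 < t -> 0 < omega t) ->
  (forall x p, A x -> ((omega (mdist p p0))%:E <= phi (x, p))%E) ->
  (snd \o z) @ \oo --> p0.
Proof.
move=> omega_nd omega_gt0 omega_phi.
apply/cvg_ballP => e e0.
apply: filterS (phi_sequence_small (omega_gt0 _ e0)) => k phik.
rewrite ballEmdist /= metric_sym ltNge; apply/negP => /(omega_nd _ _ (ltW e0)).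
have := omega_phi (z k).1 (z k).2 (z_A k); rewrite -surjective_pairing.
by move=> /le_lt_trans/(_ phik); rewrite lte_fin ltNge => /negP.
Qed.

(** Feasibility comes first: semicontinuity of [phi] gives [phi (x, p0) <= e] for every positive
    [e]. Only then can semicontinuity of [f] be used at [x], with [f (z k).1] at most the penalty
    value and so below [v]. *)
Lemma sequence_cluster_optimal (x xs : X) :
  lsc_on (feasible M A) f -> lsc_on (A `*` [set p0]) phi ->
  optimal_solution M A f xs -> f xs = v%:E ->
  A x -> cluster (z @ \oo) (x, p0) ->
  optimal_solution M A f x.
Proof.
move=> f_lsc phi_lsc [_ xsmin] fxs Ax zx.
have Mx : M x.
  apply: (proj2 ((phi_eq0 x p0).1 _)); apply/eqP; rewrite eq_le phi_ge0 andbT.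
  apply/lee_addgt0Pr => e e0; rewrite add0e.
  apply: (cluster_lsc_le zx phi_lsc); first by [].
  have := phi_sequence_small e0.
  by apply: (@filterS _ \oo) => k /= /ltW.
split=> // y /xsmin; apply: le_trans; rewrite fxs.
apply: (@cluster_lsc_le _ _ ((fst \o z) @ \oo) _ _ _ _ _ f_lsc) => //.
  by apply: (cluster_image (h := fst)) zx; exact: cvg_fst.
by apply: (@filterE _ \oo) => k /=; rewrite (le_trans _ (ltW (z_lt k)))// penalty_ge.
Qed.

(** For any candidate [l0], monotonicity in the parameter puts the value of [penalty f phi l0] at
    [z k] below [v], its value at [(x, p0)], once [k] reaches [l0]; such points occur in every
    neighbourhood. *)
Lemma sequence_cluster_not_exact (x : X) :
  M x -> f x = v%:E -> cluster (z @ \oo) (x, p0) -> ~ exact_at A f phi p0 x.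
Proof.
move=> Mx fx zx [l0 _ [_ locmin]].
pose E := [set w | A w.1 /\ (penalty f phi l0 w < v%:E)%E].
have zE : \forall k \near \oo, E (z k).
  near=> k; split=> //=; apply: le_lt_trans (z_lt k); apply: le_penalty.
  by near: k; exact: nbhs_infty_ger.
have [w [[Aw] + wmin]] := zx E _ zE locmin.
by rewrite -fx -(penalty_feasible l0 Mx) ltNge wmin.
Unshelve. all: by end_near. Qed.

End penalty_sequence.
End penalty_theory.

Theorem theorem3p8 (R : realType) (X : normedModType R) (P : metricType R)
    (M A : set X) (f : X -> \bar R) (phi : X * P -> \bar R) (p0 : P)
    (M_neq0 : M !=set0) (A_neq0 : A !=set0)
    (f_gtNy : forall x, f x != -oo%E)
    (dom_neq0 : dom f !=set0)
    (min_attained : exists2 x, optimal_solution M A f x & f x \is a fin_num)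
    (phi_ge0 : forall z, (0 <= phi z)%E)
    (phi_eq0 : forall x p, phi (x, p) = 0%E <-> p = p0 /\ M x)
    (X_findim : finite_dimensional X)
    (A_closed : closed A)
    (f_lsc : lsc_on (feasible M A) f)
    (phi_lsc : lsc_on (A `*` [set p0]) phi)
    (omega_ex : exists omega : R -> R,
      [/\ (forall t, 0 <= t -> 0 <= omega t),
          (forall s t, 0 <= s -> s <= t -> omega s <= omega t),
          (forall t, 0 <= t -> (omega t = 0 <-> t = 0)) &
          (forall x p, A x -> ((omega (mdist p p0))%:E <= phi (x, p))%E)]) :
  globally_exact M A f phi p0 <->
  (forall x, optimal_solution M A f x -> exact_at A f phi p0 x) /\
  (exists mu : R, [/\ 0 <= mu,
    let S := [set x | A x /\
      (ereal_inf [set penalty f phi mu (x, p) | p in [set: P]]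
         < optimal_value M A f)%E] in
    bounded_set S \/ S = set0 &
    exists c : R, forall x p, A x -> (c%:E <= penalty f phi mu (x, p))%E]).
Proof.
have [xs xs_opt fxs_fin] := min_attained.
have [v fxs] : exists v, f xs = v%:E by exists (fine (f xs)); rewrite fineK.
rewrite (optimal_valueE xs_opt) fxs.
have [[Mxs Axs] xsmin] := xs_opt.
split=> [[l [l0 _ glob]]|[exact_opt [mu [mu0 /= S_bnd [c lb_mu]]]]].
  (* This bound makes [l] serve as [mu] too: the sublevel set is empty and [v] is a lower bound. *)
  have lb x p : A x -> (v%:E <= penalty f phi l (x, p))%E.
    move=> Ax; have [_] := (glob xs p0).2 (conj erefl xs_opt).
    move=> /(_ (x, p) (conj Ax I)).
    by rewrite (penalty_feasible f phi_eq0)// fxs.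
  split=> [x x_opt|].
    exists l => //; have [Axp xmin] := (glob x p0).2 (conj erefl x_opt).
    by split=> //; exact: filterE.
  exists l; split=> //; last by exists v.
  right; apply/seteqP; split=> // x [Ax] /=; rewrite ltNge => /negP; apply.
  by apply: le_ereal_inf_tmp => _ [p _ <-]; exact: lb.
have [omega [omega_ge0 omega_nd omega_eq0 omega_phi]] := omega_ex.
have omega_gt0 t : 0 < t -> 0 < omega t.
  move=> t0; rewrite lt_neqAle omega_ge0 ?(ltW t0)// andbT eq_sym.
  by apply/eqP => /(omega_eq0 _ (ltW t0)) t_eq0; rewrite t_eq0 ltxx in t0.
have [[k lb]|no_lb] := pselect (exists k : nat,
    forall z, A z.1 -> (v%:E <= penalty f phi k%:R z)%E).
  exact: (penalty_lower_bound_exact f_gtNy phi_ge0 phi_eq0 (ler0n _ k) xs_opt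
    fxs lb).
have /choice[z zP] : forall k : nat, exists z,
    A z.1 /\ (penalty f phi k%:R z < v%:E)%E.
  move=> k; apply/not_existsP => nz; apply: no_lb; exists k => z Az.
  by rewrite leNgt; apply/negP => zv; apply: (nz z).
have z_A k : A (z k).1 by case: (zP k).
have z_lt k : (penalty f phi k%:R (z k) < v%:E)%E by case: (zP k).
have z_ge k : (c%:E <= penalty f phi mu (z k))%E.
  by rewrite [z k]surjective_pairing; exact: lb_mu.
set S := [set x | _] in S_bnd.
have {S_bnd} [B SB] : exists B, S `<=` [set x | `|x| <= B].
  by case: S_bnd => [/bounded_setP//|->]; exists 0.
(* [S] may fail to be closed, so the compact set is the part of [A] in a closed ball containing [S];
   this also keeps the cluster point in [A]. *)
have K_compact : compact (A `&` [set x | `|x| <= B]).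
  apply: finite_dimensional_bounded_closed_compact => //.
    by apply/bounded_setP; exists B => x [].
  apply: closedI => //.
  apply: (@preimage_closed X R Num.norm [set r | r <= B]).
    by move=> x _; exact: norm_continuous.
  exact: closed_le.
(* From [k >= mu] on, the infimum over [p] of [penalty f phi mu] at [(z k).1] is at most the value
   of [penalty f phi k%:R] at [z k], hence below [v]. *)
have zK : \forall k \near \oo, (A `&` [set x | `|x| <= B]) (z k).1.
  near=> k; split=> //; apply: SB; split=> //.
  apply: le_lt_trans (z_lt k).
  apply: (@le_trans _ _ (penalty f phi mu (z k))).
    by apply: ereal_inf_lbound; exists (z k).2; rewrite -?surjective_pairing.
  by apply: le_penalty => //; near: k; exact: nbhs_infty_ger.
have [x [[Ax _] zx]] := K_compact ((fst \o z) @ \oo) _ zK.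
have zxp : cluster (z @ \oo) (x, p0).
  apply: cluster_pair => //.
  exact: (parameter_sequence_cvg f_gtNy phi_ge0 z_A z_lt z_ge omega_nd
    omega_gt0).
have x_opt : optimal_solution M A f x.
  exact: (sequence_cluster_optimal f_gtNy phi_ge0 phi_eq0 z_lt z_ge f_lsc
    phi_lsc xs_opt fxs).
have [[Mx _] xmin] := x_opt.
have fx : f x = v%:E.
  by apply/eqP; rewrite eq_le -fxs xmin// xsmin.
by have := sequence_cluster_not_exact phi_ge0 phi_eq0 z_A z_lt Mx fx zxp
  (exact_opt _ x_opt).
Unshelve. all: by end_near. Qed.
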